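(* Let $I$ and $K$ be two admissible ideals on a non-empty set $S$, let $X$ be a topological space, $x\in X$, and let $f:S\to X$ be a function that is $I^{K^*}$-convergent to $x$. Then $f$ is $I^K$-convergent to $x$.
   Context: An ideal on a non-empty set $S$ is a family $I\subset 2^S$ closed under finite unions and under taking subsets. It is non-trivial if $S\notin I$ and $I\neq\{\emptyset\}$. A non-trivial ideal on $S$ is admissible if it contains every singleton $\{s\}$, $s\in S$. The associated filter is $F(I)=\{A\subset S: S\setminus A\in I\}$. $\mathrm{Fin}(S)$ is the ideal of all finite subsets of $S$. For an ideal $J$ on $S$, a function $g:S\to X$ is $J$-convergent to $x$ if $\{s\in S: g(s)\notin U\}\in J$ for every neighborhood $U$ of $x$. A function $f:S\to X$ is $I^K$-convergent to $x$ if there is $M\in F(I)$ such that the function $g$ given by $g(s)=f(s)$ for $s\in M$, $g(s)=x$ for $s\notin M$, is $K$-convergent to $x$. A function $f:S\to X$ is $I^{K^*}$-convergent to $x$ if there are $M\in F(I)$ and $M_1\in F(K)$ such that the function $g$ given by $g(s)=f(s)$ for $s\in M\cap M_1$, $g(s)=x$ for $s\notin M\cap M_1$, is $\mathrm{Fin}(S)$-convergent to $x$. *)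

(* Defs.v *)
From mathcomp Require Import all_boot.
From mathcomp Require Import boolp classical_sets functions cardinality.
From mathcomp Require Import topology.

Set Implicit Arguments.
Unset Strict Implicit.
Unset Printing Implicit Defensive.

Local Open Scope classical_set_scope.

(* Closure under finite unions: the empty union [ideal_set0] and binary
   unions [ideal_setU]. *)
Record is_ideal (S : Type) (I : set (set S)) : Prop := {
  ideal_set0 : I set0;
  ideal_setU : forall A B : set S, I A -> I B -> I (A `|` B);
  ideal_sub : forall A B : set S, A `<=` B -> I B -> I A
}.

Definition nontrivial_ideal (S : Type) (I : set (set S)) : Prop :=
  [/\ is_ideal I, ~ I [set: S] & I <> [set set0]].

Definition admissible_ideal (S : Type) (I : set (set S)) : Prop :=
  nontrivial_ideal I /\ forall s : S, I [set s].

Definition assoc_filter (S : Type) (I : set (set S)) : set (set S) :=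
  [set A | I (~` A)].

Definition Fin (S : Type) : set (set S) := [set A | finite_set A].

Definition ideal_cvg (S : Type) (X : topologicalType) (J : set (set S))
    (g : S -> X) (x : X) : Prop :=
  forall U : set X, nbhs x U -> J [set s | ~ U (g s)].

(* [patch (fun=> x) M f] equals [f] on [M] and is constantly [x] off [M]. *)
Definition IK_cvg (S : Type) (X : topologicalType) (I K : set (set S))
    (f : S -> X) (x : X) : Prop :=
  exists2 M : set S, assoc_filter I M &
    ideal_cvg K (patch (fun=> x) M f) x.

Definition IKstar_cvg (S : Type) (X : topologicalType) (I K : set (set S))
    (f : S -> X) (x : X) : Prop :=
  exists M M1 : set S,
    [/\ assoc_filter I M, assoc_filter K M1 &
        ideal_cvg (@Fin S) (patch (fun=> x) (M `&` M1) f) x].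

(* Main.v *)
Require Import Defs.
From mathcomp Require Import all_boot.
From mathcomp Require Import boolp classical_sets functions cardinality.
From mathcomp Require Import topology.

(** Let [M] and [M1] witness the hypothesis; the same [M] witnesses the
conclusion.  Fix a neighbourhood [U] of [x].  On [M1], replacing [f] by [x] off
[M] or off [M `&` M1] gives the same values, so the points of [M1] sent outside
[U] by the first function are among the finitely many sent there by the second,
and an admissible ideal contains every finite set ([admissible_finite]).  The
remaining points lie in [~` M1], which belongs to [K]. *)

Local Open Scope classical_set_scope.

Lemma admissible_finite {S : Type} {K : set (set S)} {A : set S} :
  admissible_ideal K -> finite_set A -> K A.
Proof.
(* Finite sets are spanned by sequences only over an [eqType]; [{classic S}] is
   [S] with its classically decidable equality. *)
move=> [[[K0 KU Ksub] _ _] K1] /(@finite_seqP {classic S})[s ->].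
elim: s => [|a s IHs]; first by rewrite set_nil.
apply: Ksub (KU _ _ (K1 a) IHs) => t /=.
by rewrite inE => /predU1P.
Qed.

Theorem lemma4p2 (S : Type) (S_neq0 : [set: S] !=set0)
    (I K : set (set S))
    (admI : admissible_ideal I) (admK : admissible_ideal K)
    (X : topologicalType) (x : X) (f : S -> X) :
  IKstar_cvg I K f x -> IK_cvg I K f x.
Proof.
move=> [M [M1 [IM KM1 cvgf]]]; exists M => // U Ux.
have [[[_ KU Ksub] _ _] _] := admK.
apply: Ksub (KU _ _ KM1 (admissible_finite admK (cvgf U Ux))).
move=> s /= notUs; have [M1s|] := pselect (M1 s); last by left.
right; suff -> : patch (fun=> x) (M `&` M1) f s = patch (fun=> x) M f s by [].
by rewrite /patch in_setI (mem_set M1s) andbT.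
Qed.
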